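(* Let $X$ and $Y$ be Banach spaces and assume that $X$ has a normalized weakly null sequence whose spreading model is isomorphic to (i.e. equivalent to) the standard basis of $c_0$. Assume that there exists a weakly sequentially continuous map $f:X\to Y$ which is coarse and satisfies Property $( * )$. Then $Y$ is not AUCable, i.e. no equivalent norm on $Y$ is asymptotically uniformly convex.
   Context: Maps. For a map $f:X\to Y$ between Banach spaces (not assumed linear) let $\omega_f(t)=\sup\{\|f(x)-f(y)\| : \|x-y\|\le t\}$ for $t\ge 0$. The map $f$ is coarse if $\omega_f(t)<\infty$ for all $t\ge 0$. It satisfies Property $( * )$ if there exist $\beta>\alpha>0$ such that $\inf_{\|x-y\|\in[\alpha,\beta]}\|f(x)-f(y)\|>0$. It is weakly sequentially continuous if $x_n\to x$ weakly in $X$ implies $f(x_n)\to f(x)$ weakly in $Y$. Asymptotic uniform convexity. For a Banach space $Y$ and $t\ge 0$, \[\overline{\delta}_Y(t)=\inf_{x\in\partial B_Y}\ \sup_{E\in\mathrm{cof}(Y)}\ \inf_{y\in\partial B_E}\|x+ty\|-1,\] where $\partial B$ denotes the unit sphere and $\mathrm{cof}(Y)$ is the set of closed finite-codimensional subspaces of $Y$. $Y$ is asymptotically uniformly convex (AUC) if $\overline{\delta}_Y(t)>0$ for all $t\in(0,1]$, and AUCable if it admits an equivalent norm for which it is AUC. Spreading models. Let $(x_n)_n$ be a bounded sequence without Cauchy subsequences in a Banach space $(X,\|\cdot\|)$. A sequence $(e_n)_n$ in a Banach space $(S,\|\cdot\|_S)$ is the spreading model of $(x_n)_n$ if for all $\varepsilon>0$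 and $k\in\mathbb{N}$ there is $\ell\in\mathbb{N}$ such that $\big|\,\|\sum_{i=1}^k a_ix_{n_i}\|-\|\sum_{i=1}^k a_ie_i\|_S\,\big|\le\varepsilon$ for all $\ell\le n_1<\ldots<n_k$ and all $a_1,\ldots,a_k\in[-1,1]$. *)

(* Defs.v *)
From HB Require Import structures.
From mathcomp Require Import all_boot all_order all_algebra.
From mathcomp Require Import all_classical all_reals all_analysis.

Set Implicit Arguments.
Unset Strict Implicit.
Unset Printing Implicit Defensive.

Import Order.TTheory GRing.Theory Num.Theory.
Import numFieldNormedType.Exports.

Local Open Scope classical_set_scope.
Local Open Scope ring_scope.

Definition weakly_cvg (R : realType) (X : normedModType R)
    (x : nat -> X) (l : X) : Prop :=
  forall phi : {linear X -> R^o}, continuous phi ->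
    (fun n => phi (x n)) @ \oo --> phi l.

Definition weakly_seq_continuous (R : realType) (X Y : normedModType R)
    (f : X -> Y) : Prop :=
  forall (x : nat -> X) (l : X),
    weakly_cvg x l -> weakly_cvg (fun n => f (x n)) (f l).

Definition expansion_modulus (R : realType) (X Y : normedModType R)
    (f : X -> Y) (t : R) : \bar R :=
  ereal_sup [set `|f p.1 - f p.2|%:E |
             p in [set p : X * X | `|p.1 - p.2| <= t]].

Definition coarse (R : realType) (X Y : normedModType R) (f : X -> Y) : Prop :=
  forall t : R, 0 <= t -> (expansion_modulus f t < +oo)%E.

Definition property_star (R : realType) (X Y : normedModType R)
    (f : X -> Y) : Prop :=
  exists alpha beta : R, [/\ 0 < alpha, alpha < beta &
    (0 < ereal_inf [set `|f p.1 - f p.2|%R%:E |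
           p in [set p : X * X |
                 (alpha <= `|p.1 - p.2| <= beta)%R]])%E].

(* Renormings of [Y] are given by a norm function [N : Y -> R] on the fixed
   vector space [Y]. *)
Definition is_norm (R : realType) (Y : lmodType R) (N : Y -> R) : Prop :=
  [/\ forall y z, N (y + z) <= N y + N z,
      forall (a : R) y, N (a *: y) = `|a| * N y
    & forall y, N y = 0 -> y = 0].

Definition equivalent_norm (R : realType) (Y : normedModType R)
    (N : Y -> R) : Prop :=
  is_norm N /\
  exists A B : R, [/\ 0 < A, 0 < B &
    forall y, A * `|y| <= N y /\ N y <= B * `|y|].

Definition finite_codim (R : realType) (Y : lmodType R) (E : set Y) : Prop :=
  exists (m : nat) (v : 'I_m -> Y), forall y : Y,
    exists (z : Y) (a : 'I_m -> R), E z /\ y = z + \sum_(i < m) a i *: v i.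

(* Closedness is taken for the given norm of [Y]; an equivalent norm has the
   same closed sets. *)
Definition cof (R : realType) (Y : normedModType R) : set (set Y) :=
  [set E | [/\ GRing.submod_closed (mem E), closed E & finite_codim E]].

Definition unit_sphere (R : realType) (Y : lmodType R) (N : Y -> R)
    (E : set Y) : set Y :=
  [set y | E y /\ N y = 1].

(* The infimum over an empty sphere is +oo, so finite-dimensional spaces are
   AUC. *)
Definition auc_modulus (R : realType) (Y : normedModType R) (N : Y -> R)
    (t : R) : \bar R :=
  (ereal_inf [set ereal_sup [set ereal_inf [set (N (x + t *: y)%R)%:E |
                                            y in unit_sphere N E] |
                             E in @cof R Y] |
              x in unit_sphere N setT] - 1)%E.

Definition AUC (R : realType) (Y : normedModType R) (N : Y -> R) : Prop :=
  forall t : R, 0 < t -> t <= 1 -> (0 < auc_modulus N t)%E.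

Definition AUCable (R : realType) (Y : normedModType R) : Prop :=
  exists N : Y -> R, equivalent_norm N /\ AUC N.

Definition no_cauchy_subseq (R : realType) (X : normedModType R)
    (x : nat -> X) : Prop :=
  forall sigma : nat -> nat, {homo sigma : i j / (i < j)%N} ->
    ~ cauchy ((fun n => x (sigma n)) @ \oo).

Definition spreading_model (R : realType) (X S : normedModType R)
    (x : nat -> X) (e : nat -> S) : Prop :=
  [/\ bounded_fun x, no_cauchy_subseq x &
    forall (eps : R) (k : nat), 0 < eps -> exists l : nat,
      forall (n : 'I_k -> nat) (a : 'I_k -> R),
        (forall i, (l <= n i)%N) ->
        {homo n : i j / (i < j)%N} ->
        (forall i, -1 <= a i <= 1) ->
        `| `|\sum_(i < k) a i *: x (n i)| - `|\sum_(i < k) a i *: e i| | <= eps].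

Definition c0_norm (R : realType) (u : nat -> R) : R :=
  sup (range (fun n => `|u n|)).

Definition c0_basis (R : realType) (i : nat) : nat -> R :=
  fun n => (n == i)%:R.

Definition equiv_c0_basis (R : realType) (S : normedModType R)
    (e : nat -> S) : Prop :=
  exists A B : R, [/\ 0 < A, 0 < B &
    forall (k : nat) (a : 'I_k -> R),
      let c := c0_norm (fun n => \sum_(i < k) a i * c0_basis R i n) in
      A * c <= `|\sum_(i < k) a i *: e i| /\
      `|\sum_(i < k) a i *: e i| <= B * c].

(* Main.v *)
(* Fix [u] and let [x_n] be the given weakly null sequence.  The increments
   [f (u + a x_n) - f u] are weakly null and, by Property ( * ), bounded away
   from 0, so for an AUC norm adding one of them to [f u - f 0] increases the
   norm by a constant that depends only on upper and lower bounds for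
   [f u - f 0].  Hence the norm of [f (a (x_(n_1) + ... + x_(n_k))) - f 0] can be
   made to grow linearly in [k]; but the c0 spreading model bounds the sums and
   coarseness bounds their images. *)
Require Import Defs.
From HB Require Import structures.
From mathcomp Require Import all_boot all_order all_algebra.
From mathcomp Require Import all_classical all_reals all_analysis.
From mathcomp Require Import lra.

Set Implicit Arguments.
Unset Strict Implicit.
Unset Printing Implicit Defensive.

Import Order.TTheory GRing.Theory Num.Theory.
Import numFieldNormedType.Exports.

Local Open Scope classical_set_scope.
Local Open Scope ring_scope.

(** * Closed subspaces of finite codimension and continuous functionals *)

Section Submodules.
Context {R : realType} {Y : normedModType R}.
Implicit Types (E : set Y) (v : Y).

Lemma submod_set0 E : GRing.submod_closed (mem E) -> E 0.
Proof. by move=> [/set_mem]. Qed.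

Lemma submod_setP E : GRing.submod_closed (mem E) ->
  forall (a : R) y z, E y -> E z -> E (a *: y + z).
Proof.
by move=> [_ h] a y z Ey Ez; apply/set_mem/h; exact/mem_set.
Qed.

Lemma submod_setZ E : GRing.submod_closed (mem E) ->
  forall (a : R) y, E y -> E (a *: y).
Proof.
move=> hE a y Ey; rewrite -[_ *: _]addr0.
exact: submod_setP (submod_set0 hE).
Qed.

Lemma submod_setD E : GRing.submod_closed (mem E) ->
  forall y z, E y -> E z -> E (y + z).
Proof. by move=> hE y z Ey Ez; rewrite -[y]scale1r; exact: submod_setP. Qed.

Lemma submod_setB E : GRing.submod_closed (mem E) ->
  forall y z, E y -> E z -> E (y - z).
Proof.
by move=> hE y z Ey Ez; rewrite addrC -scaleN1r; exact: submod_setP.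
Qed.

(** The sum of [E] and the line spanned by [v]. *)
Definition add_line E v : set Y := [set y | exists c : R, E (y - c *: v)].

Lemma submod_closed_add_line E v :
  GRing.submod_closed (mem E) -> GRing.submod_closed (mem (add_line E v)).
Proof.
move=> hE; split.
  by apply/mem_set; exists 0; rewrite scale0r subr0; exact: submod_set0.
move=> a y z /set_mem[c Ec] /set_mem[d Ed]; apply/mem_set; exists (a * c + d).
have -> : a *: y + z - (a * c + d) *: v = a *: (y - c *: v) + (z - d *: v).
  by rewrite scalerDl -scalerA scalerBr opprD addrACA.
exact: submod_setP.
Qed.

(** Take [d] with the ball of radius [d] about [v] disjoint from [E]. For [c] nonzero,
    [v - c^-1 *: y] lies in [E], so [c^-1 *: y] has norm at least [d]. This is the continuity of the
    coefficient along [v]. *)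
Lemma line_coef_bound E v :
  GRing.submod_closed (mem E) -> closed E -> ~ E v ->
  exists2 d : R, 0 < d & forall y c, E (y - c *: v) -> d * `|c| <= `|y|.
Proof.
move=> hE cE nEv.
have /nbhs_ballP[d /= d0 dE] : nbhs v (~` E).
  by apply: open_nbhs_nbhs; split => //; exact: closed_openC.
exists d => // y c Ey.
have [->|c0] := eqVneq c 0; first by rewrite normr0 mulr0.
have hc : 0 < `|c| by rewrite normr_gt0.
rewrite leNgt; apply/negP => ylt.
apply: (dE (v - c^-1 *: y)).
  rewrite -ball_normE /= opprB addrC subrK normrZ normfV.
  by rewrite mulrC ltr_pdivrMr.
have -> : v - c^-1 *: y = (- c^-1) *: (y - c *: v).
  by rewrite scalerBr scalerA mulNr mulVf // scaleN1r opprK scaleNr addrC.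
exact: submod_setZ.
Qed.

(** If [v] is outside [E], points of the sum converging to [y] have Cauchy coefficients along [v] by
    [line_coef_bound]. With [c] their limit, [y - c *: v] is a limit of points of [E]. *)
Lemma closed_add_line E v :
  GRing.submod_closed (mem E) -> closed E -> closed (add_line E v).
Proof.
move=> hE cE; have [Ev|nEv] := pselect (E v).
  rewrite (_ : add_line E v = E) //; apply/seteqP; split => y /=.
    move=> [c Ec]; rewrite -(subrK (c *: v) y).
    by apply: submod_setD => //; exact: submod_setZ.
  by move=> Ey; exists 0; rewrite scale0r subr0.
have [d d0 hd] := line_coef_bound hE cE nEv.
move=> y cly.
have /choice[z hz] (n : nat) : exists p : Y * R,
    E (p.1 - p.2 *: v) /\ `|y - p.1| < n.+1%:R^-1.
  have [z [[c Ec] yz]] := cly _ (nbhsx_ballx y n.+1%:R^-1 ltac:(by [])).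
  by exists (z, c); split => //; rewrite -ball_normE in yz.
have zy : (z n).1 @[n --> \oo] --> y.
  apply/cvgrPdist_lt => e e0; near=> n; apply: (lt_trans (hz n).2).
  by near: n; exact: near_infty_natSinv_lt (PosNum e0).
have zc : cvg ((z n).2 @[n --> \oo]).
  apply/cauchy_cvgP/cauchy_exP => e e0.
  have de : 0 < d * e / 2 by rewrite divr_gt0// mulr_gt0.
  have /cvgrPdist_lt/(_ _ de)[N _ hN] := zy.
  exists (z N).2; exists N => // n /= Nn; rewrite -ball_normE /=.
  rewrite -(ltr_pM2l d0).
  have ENn : E ((z N).1 - (z n).1 - ((z N).2 - (z n).2) *: v).
    have := submod_setB hE (hz N).1 (hz n).1; congr E.
    by rewrite scalerBl !opprD !opprK addrACA.
  apply: (le_lt_trans (hd _ _ ENn)).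
  have := ler_distD y (z N).1 (z n).1.
  have := hN N (leqnn N); have := hN n Nn => /=; rewrite (distrC (z N).1 y).
  lra.
set c := lim ((z n).2 @[n --> \oo]).
exists c.
apply: (closed_cvg (F := \oo) (u_ := fun n => (z n).1 - (z n).2 *: v)) => //.
  by near=> n; exact: (hz n).1.
by apply: cvgB => //; exact: cvgZr_tmp.
Unshelve. all: by end_near. Qed.

(** Turns a finite spanning complement into continuous functionals, which is what weak convergence
    can test. By induction on [m], the last vector [w] is absorbed into [E]; if [w] is not in [E],
    its coefficient becomes one more functional. *)
Lemma finite_codim_functionals m (v : 'I_m -> Y) E :
  GRing.submod_closed (mem E) -> closed E ->
  (forall y, exists (z : Y) (a : 'I_m -> R),
     E z /\ y = z + \sum_(i < m) a i *: v i) ->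
  exists (k : nat) (phi : 'I_k -> {linear Y -> R^o}) (u : 'I_k -> Y),
    (forall i, continuous (phi i)) /\
    forall y, E (y - \sum_(i < k) (phi i y : R) *: u i).
Proof.
elim: m v E => [|m IH] v E hE cE hv.
  exists 0%N, (fun=> \0), (fun=> 0); split; first by case.
  move=> y; have [z [a [Ez ->]]] := hv y.
  by rewrite !big_ord0 addr0 subr0.
set w := v ord_max.
have [|k [phi [u [cphi hphi]]]] :=
    IH (fun i => v (widen_ord (leqnSn m) i)) (add_line E w)
       (submod_closed_add_line _ hE) (closed_add_line hE cE).
  move=> y; have [z [a [Ez ->]]] := hv y.
  exists (z + a ord_max *: w), (fun i => a (widen_ord (leqnSn m) i)); split.
    by exists (a ord_max); rewrite addrK.
  by rewrite big_ord_recr /= -addrA; congr (_ + _); rewrite addrC.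
have [Ew|nEw] := pselect (E w).
  exists k, phi, u; split => // y; have [c Ec] := hphi y.
  rewrite -(subrK (c *: w) (y - _)); apply: submod_setD => //.
  exact: submod_setZ.
have [d d0 hd] := line_coef_bound hE cE nEw.
(* The remainder [y - P y] lies in [E] plus the line of [w]. Its coefficient [c y] is unique because
   [w] is not in [E], and uniqueness makes [c] linear. *)
pose P y := \sum_(i < k) (phi i y : R) *: u i.
have /choice[c hc] := hphi; rewrite -/(P _) in hc.
have cU a b y : E (y - a *: w) -> E (y - b *: w) -> a = b.
  move=> Ea Eb; apply/eqP; rewrite -subr_eq0 -normr_le0.
  have := hd 0 (a - b); rewrite normr0 pmulr_rle0 //; apply.
  have := submod_setB hE Ea Eb; congr E.
  by rewrite sub0r scalerBl opprD opprK addrACA subrr add0r opprD opprK.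
have PD a y z : P (a *: y + z) = a *: P y + P z.
  rewrite /P scaler_sumr -big_split /=; apply: eq_bigr => i _.
  by rewrite linearP scalerDl scalerA.
have clin : linear (c : Y -> R^o).
  move=> a y z; apply: (cU _ _ (a *: y + z - P (a *: y + z))); first exact: hc.
  have := submod_setP hE a (hc y) (hc z); congr E.
  rewrite PD !scalerBr scalerDl -scalerA !opprD addrACA; congr (_ + _).
  by rewrite addrACA.
pose psi : {linear Y -> R^o} := HB.pack (c : Y -> R^o)
  (GRing.isLinear.Build R Y R^o *:%R (c : Y -> R^o) clin).
have cP : continuous P.
  move=> y; apply: cvg_big => [|i _]; first exact: add_continuous.
  by apply: cvgZr_tmp; exact: cphi.
(* Continuity at 0 suffices, and there [d] times the modulus of [psi y] is at most the norm of
   [y - P y], which tends to 0. *)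
have cpsi : continuous psi.
  apply: continuousfor0_continuous; apply/cvgrPdist_lt => e e0.
  rewrite linear0.
  have P0 : P 0 = 0 by rewrite /P big1 // => i _; rewrite linear0 scale0r.
  have /cvgrPdist_lt/(_ _ (mulr_gt0 d0 e0)) :
      (fun y => y - P y) @ (0 : Y) --> 0 - P 0.
    by apply: cvgB => //; exact: cP.
  apply: filterS => y; rewrite P0 subrr !sub0r !normrN => h.
  by rewrite -(ltr_pM2l d0); apply: le_lt_trans h; exact: hd.
exists k.+1, (fun i => if unlift ord0 i is Some j then phi j else psi),
  (fun i => if unlift ord0 i is Some j then u j else w).
split; first by move=> i; case: unlift => [j|]; [exact: cphi|exact: cpsi].
move=> y; rewrite big_ord_recl unlift_none /=.
under eq_bigr => i _ do rewrite liftK.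
by rewrite opprD addrA addrAC; exact: hc.
Qed.

End Submodules.

(** * Weakly null sequences against the AUC modulus *)

Section WeakAUC.
Context {R : realType} {Y : normedModType R}.

(** The correction that moves [w n] into [E] is a finite sum with coefficients [phi i (w n)], each
    tending to 0. *)
Lemma weakly_null_near_cof (E : set Y) (w : nat -> Y) (e : R) :
  cof E -> weakly_cvg w 0 -> 0 < e ->
  \forall n \near \oo, exists2 z, E z & `|w n - z| < e.
Proof.
move=> [hE cE [m [v hv]]] w0 e0.
have [k [phi [u [cphi hphi]]]] := finite_codim_functionals hE cE hv.
have : \sum_(i < k) (phi i (w n) : R) *: u i @[n --> \oo] -->
    \sum_(i < k) (phi i 0 : R) *: u i.
  apply: cvg_big => [|i _]; first exact: add_continuous.
  by apply: cvgZr_tmp; exact: w0.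
rewrite big1 => [|i _]; last by rewrite linear0 scale0r.
move=> /cvgr0Pnorm_lt/(_ _ e0); apply: filterS => n h.
by exists (w n - \sum_(i < k) (phi i (w n) : R) *: u i); rewrite // subKr.
Qed.

(** The gap [d] comes from the infimum over the sphere, so it is uniform in [x]; only the subspace
    [E], chosen from the supremum, depends on [x]. *)
Lemma AUC_gap (N : Y -> R) (t : R) : AUC N -> 0 < t <= 1 ->
  exists2 d : R, 0 < d & forall x, N x = 1 ->
    exists2 E, cof E & forall y, E y -> N y = 1 -> 1 + d <= N (x + t *: y).
Proof.
move=> aN /andP[t0 t1]; have := aN t t0 t1; rewrite /auc_modulus.
set I := ereal_inf _; rewrite lteBrDl // adde0 => I1.
have [d d0 dI] : exists2 d : R, 0 < d & ((1 + d)%:E < I)%E.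
  move: I1; case: I => [r| |] //.
    rewrite lte_fin => r1; exists ((r - 1) / 2); first by rewrite divr_gt0// subr_gt0.
    by rewrite lte_fin; lra.
  by exists 1 => //; rewrite ltry.
exists d => // x Nx.
have : ((1 + d)%:E < ereal_sup [set ereal_inf [set (N (x + t *: y)%R)%:E |
   y in unit_sphere N E] | E in @cof R Y])%E.
  by apply: (lt_le_trans dI); apply: ereal_inf_lbound; exists x.
move=> /ereal_sup_gt[_ [E cE <-]] h; exists E => // y Ey Ny.
rewrite -lee_fin; apply: le_trans (ltW h) _.
by apply: ereal_inf_lbound; exists y.
Qed.

End WeakAUC.

(** * Elementary norm inequalities and the growth estimate *)

Section NormFacts.
Context {R : realType} {Y : lmodType R} (N : Y -> R) (hN : is_norm N).

Lemma is_norm0 : N 0 = 0.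
Proof. by have [_ h _] := hN; rewrite -(scale0r (0 : Y)) h normr0 mul0r. Qed.

Lemma is_normN y : N (- y) = N y.
Proof. by have [_ h _] := hN; rewrite -scaleN1r h normrN1 mul1r. Qed.

Lemma is_norm_ge0 y : 0 <= N y.
Proof.
have [h _ _] := hN; have := h y (- y).
by rewrite subrr is_norm0 is_normN; lra.
Qed.

Lemma is_norm_leB y z : N y <= N z + N (y - z).
Proof. by have [h _ _] := hN; rewrite -{1}(subrKC z y). Qed.

(* Convexity of [s |-> N (x + s *: y)], which takes the value 1 at 0. *)
Lemma is_norm_ray_ge (x y : Y) (t s d : R) : N x = 1 -> 0 <= d -> 0 < t <= s ->
  1 + d <= N (x + t *: y) -> 1 + d <= N (x + s *: y).
Proof.
have [hD hZ _] := hN => Nx d0 /andP[t0 ts] h.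
have s0 : 0 < s by exact: lt_le_trans ts.
set q := t / s.
have q0 : 0 < q by exact: divr_gt0.
have q1 : q <= 1 by rewrite ler_pdivrMr // mul1r.
have e : x + t *: y = (1 - q) *: x + q *: (x + s *: y).
  by rewrite scalerDr addrA -scalerDl subrK scale1r scalerA divfK // gt_eqF.
have := hD ((1 - q) *: x) (q *: (x + s *: y)).
rewrite -e !hZ Nx mulr1 ger0_norm ?subr_ge0 // gtr0_norm // => {}e.
rewrite -(ler_pM2l q0); have : q * d <= d by exact: ler_piMl.
lra.
Qed.

End NormFacts.

(** Normalize [z], replace [w n] by a nearby [e] in the subspace given by [AUC_gap], and extend the
    gap from [t] to the actual ratio [N e / N z] by convexity. Scaling back gains at least [r * d];
    half of it pays for the replacement. *)
Lemma AUC_growth (R : realType) (Y : normedModType R) (N : Y -> R) (r M : R) :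
  equivalent_norm N -> AUC N -> 0 < r -> r <= M ->
  exists2 c : R, 0 < c & forall (z : Y) (w : nat -> Y), r <= N z <= M ->
    weakly_cvg w 0 -> (forall n, r <= N (w n)) ->
    \forall n \near \oo, N z + c <= N (z + w n).
Proof.
move=> [hN [A [B [A0 B0 hAB]]]] aN r0 rM.
have M0 : 0 < M by exact: lt_le_trans rM.
(* A lower bound for [N e / N z], since [r / 2 <= N e] and [N z <= M] below. *)
pose t := r / (2 * M).
have t01 : 0 < t <= 1.
  by rewrite divr_gt0 ?mulr_gt0 //= ler_pdivrMr ?mulr_gt0 // mul1r; lra.
have /andP[t0 t1] := t01.
have [d d0 hd] := AUC_gap aN t01.
have [_ hZ _] := hN.
exists (r * d / 2); first by rewrite divr_gt0 // mulr_gt0.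
move=> z w /andP[rz zM] w0 rw.
set p := N z in rz zM *.
have p0 : 0 < p by exact: lt_le_trans rz.
have Nx : N (p^-1 *: z) = 1.
  by rewrite hZ gtr0_norm ?invr_gt0 // -/p mulVf // gt_eqF.
have [E cE hE] := hd _ Nx.
(* The first bound limits the loss to half the gain; the second keeps [N e] at least [r / 2]. *)
pose h := Num.min (r * d / 2) (r / 2).
have h0 : 0 < h by rewrite /h lt_min !divr_gt0 // mulr_gt0.
have := weakly_null_near_cof cE w0 (divr_gt0 h0 B0).
apply: filterS => n [e Ee wne].
have Nwe : N (w n - e) <= h.
  by apply: (le_trans (hAB _).2); rewrite mulrC -ler_pdivlMr // ltW.
have : h <= r * d / 2 by rewrite /h ge_min lexx.
have : h <= r / 2 by rewrite /h ge_min lexx orbT.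
move=> h1 h2.
have Ne : r / 2 <= N e.
  by have := is_norm_leB hN (w n) e; have := rw n; lra.
have Ne0 : 0 < N e by lra.
have [sE _ _] := cE.
have := hE ((N e)^-1 *: e) (submod_setZ sE _ Ee).
rewrite hZ gtr0_norm ?invr_gt0 // mulVf ?gt_eqF // => /(_ erefl) gap.
have ts : 0 < t <= N e / p.
  rewrite t0 /= /t invfM mulrA; apply: ler_pM => //.
  - by rewrite divr_ge0 // ltW.
  - by rewrite invr_ge0 ltW.
  - by rewrite lef_pV2.
have := is_norm_ray_ge hN Nx (ltW d0) ts gap.
rewrite scalerA mulrAC divff ?gt_eqF // mul1r -scalerDr hZ.
rewrite gtr0_norm ?invr_gt0 // ler_pdivlMl // => zne.
have : r * d <= p * d by rewrite ler_pM2r.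
have := is_norm_leB hN (z + e) (z + w n).
have -> : z + e - (z + w n) = - (w n - e).
  by rewrite opprD addrACA subrr add0r opprB.
rewrite is_normN //; lra.
Qed.

(** * Uniform bounds extracted from the hypotheses on [X] and [f] *)

Lemma c0_spreading_sum_bound (R : realType) (X S : normedModType R)
    (x : nat -> X) (e : nat -> S) :
  spreading_model x e -> equiv_c0_basis e ->
  exists2 C : R, 0 <= C & forall K : nat, exists l : nat,
    forall (k : nat) (n : nat -> nat), (k <= K)%N -> (forall i, (l <= n i)%N) ->
      {homo n : i j / (i < j)%N} -> `|\sum_(i < k) x (n i)| <= C.
Proof.
move=> [_ _ sp] [A [B [A0 B0 hAB]]].
(* All-ones vectors have c0 norm at most 1, which gives [B] for the sums of the [e i]; the extra 1
   is the spreading-model error. *)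
exists (B + 1) => [|K]; first by rewrite addr_ge0 // ltW.
have e_le k : `|\sum_(i < k) e i| <= B.
  have := (hAB k (fun=> 1)).2.
  under eq_bigr => i _ do rewrite scale1r.
  move=> /le_trans; apply; rewrite -[leRHS]mulr1 ler_pM2l //.
  apply: ge_sup; first by exists `|\sum_(i < k) 1 * c0_basis R i 0%N|, 0%N.
  move=> _ [n _ <-]; rewrite /c0_basis.
  under eq_bigr => i _ do rewrite mul1r.
  have [nk|kn] := ltnP n k; last first.
    by rewrite big1 ?normr0 // => i _; rewrite (gtn_eqF (leq_trans (ltn_ord i) kn)).
  rewrite (bigD1 (Ordinal nk)) //= eqxx big1 ?addr0 ?normr1 // => i ni.
  by rewrite (_ : (n == i) = false) //; apply/eqP => E; case/eqP: ni; exact: val_inj.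
have /choice[l hl] k := sp 1 k ltr01.
(* The spreading model gives one threshold per length; the maximum serves all lengths up to [K]. *)
exists (\max_(k < K.+1) l k) => k n kK ln nlt.
have := hl k (fun i => n i) (fun=> 1).
under eq_bigr => i _ do rewrite scale1r.
under [X in `|_ - `|X| |]eq_bigr => i _ do rewrite scale1r.
move=> /(_ _ _ _)/(le_trans (ler_norm _)) h.
have {h} : `|\sum_(i < k) x (n i)| - `|\sum_(i < k) e i| <= 1.
  apply: h => [i|i j|i].
  - apply: leq_trans (ln i).
    exact: (leq_bigmax (F := fun k : 'I_K.+1 => l k) (Ordinal (kK : (k < K.+1)%N))).
  - exact: nlt.
  - by lra.
have := e_le k; lra.
Qed.

Lemma property_star_lb (R : realType) (X Y : normedModType R) (f : X -> Y) :
  property_star f -> exists a g : R, [/\ 0 < a, 0 < g &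
    forall y z, `|y - z| = a -> g <= `|f y - f z|].
Proof.
move=> [a [b [a0 ab]]]; set I := ereal_inf _ => I0.
have [g g0 gI] : exists2 g : R, 0 < g & (g%:E <= I)%E.
  (* An infinite infimum, as when no pair lies at an admissible distance, is bounded below by 1. *)
  move: I0; case: I => [r| |] //; last by exists 1 => //; rewrite leey.
  by rewrite lte_fin => r0; exists r.
exists a, g; split=> // y z yz; rewrite -lee_fin; apply: (le_trans gI).
by apply: ereal_inf_lbound; exists (y, z) => //=; rewrite yz lexx ltW.
Qed.

Lemma coarse_ub (R : realType) (X Y : normedModType R) (f : X -> Y) (t : R) :
  coarse f -> 0 <= t ->
  exists W : R, forall y z, `|y - z| <= t -> `|f y - f z| <= W.
Proof.
move=> cf t0; have := cf t t0; rewrite /expansion_modulus; set I := ereal_sup _.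
move=> Ioo; exists (fine I) => y z yz.
have yI : (`|f y - f z|%:E <= I)%E by apply: ereal_sup_ubound; exists (y, z).
(* For [fine I] to be meaningful [I] must be finite: coarseness excludes [+oo], and the pair
   [(y, z)] excludes [-oo]. *)
rewrite -lee_fin fineK // fin_numE -ltey Ioo andbT.
by rewrite -ltNye (lt_le_trans _ yI) // ltNyr.
Qed.

Lemma weakly_cvg_affine (R : realType) (X : normedModType R) (x : nat -> X)
    (u : X) (a : R) :
  weakly_cvg x 0 -> weakly_cvg (fun n => u + a *: x n) u.
Proof.
move=> x0 phi cphi; rewrite -[X in _ --> X]addr0 -(mulr0 a) -(linear0 phi).
under eq_cvg => n do rewrite linearD linearZ.
apply: cvgD; first exact: cvg_cst.
by apply: cvgZl_tmp; exact: x0.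
Qed.

Lemma weakly_cvg_sub (R : realType) (X : normedModType R) (x : nat -> X)
    (l : X) :
  weakly_cvg x l -> weakly_cvg (fun n => x n - l) 0.
Proof.
move=> xl phi cphi; rewrite -(subrr l) linearB.
under eq_cvg => n do rewrite linearB.
by apply: cvgB; [exact: xl|exact: cvg_cst].
Qed.

(** * Iterated growth against the coarse bound *)

Theorem theorem1p5 (R : realType) (X Y : completeNormedModType R)
    (hX : exists x : nat -> X,
        [/\ forall n, `|x n| = 1,
            weakly_cvg x 0
          & exists (S : completeNormedModType R) (e : nat -> S),
              spreading_model x e /\ equiv_c0_basis e])
    (hf : exists f : X -> Y,
        [/\ weakly_seq_continuous f, coarse f & property_star f]) :
  ~ AUCable Y.
Proof.
move: hX hf => [x [x1 x0 [S [e [spx eqe]]]]] [f [wf cf pf]] [N [eN aN]].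
have [hN [A [B [A0 B0 hAB]]]] := eN.
have [a [g [a0 g0 hg]]] := property_star_lb pf.
have [C C0 hC] := c0_spreading_sum_bound spx eqe.
have [W hW] := coarse_ub cf (mulr_ge0 (ltW a0) C0).
(* [r] bounds below the [N]-norm of every increment along [a *: x n], and [M] bounds above that of
   the images of the sums; adding [r] to [M] ensures [r <= M]. *)
pose r := A * g; have r0 : 0 < r by exact: mulr_gt0.
pose M := `|B * W| + r; have rM : r <= M by rewrite lerDr.
have [c c0 hc] := AUC_growth eN aN r0 rM.
(* Enough steps of gain [c] to exceed [M]. Sums reach length [K.+1], as the first term only supplies
   the initial [r]. *)
pose K := Num.bound (M / c).
have [l hl] := hC K.+1.
pose F (n : nat -> nat) k := f (a *: \sum_(i < k) x (n i)) - f 0.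
have FM n k : (k <= K.+1)%N -> (forall i, (l <= n i)%N) ->
    {homo n : i j / (i < j)%N} -> N (F n k) <= M.
  move=> kK ln nlt; apply: (le_trans (hAB _).2).
  apply: (@le_trans _ _ (B * W)); last first.
    by rewrite (le_trans (ler_norm _)) // lerDl ltW.
  rewrite ler_pM2l //; apply: hW; rewrite subr0 normrZ gtr0_norm //.
  by rewrite ler_pM2l //; exact: hl.
have step u n : r <= N (f (u + a *: x n) - f u).
  apply: le_trans (hAB _).1; rewrite ler_pM2l //; apply: hg.
  by rewrite addrAC subrr add0r normrZ x1 mulr1 gtr0_norm.
have grow k : (k <= K)%N -> exists n : nat -> nat,
    [/\ forall i, (l <= n i)%N, {homo n : i j / (i < j)%N} &
      r + k%:R * c <= N (F n k.+1)].
  elim: k => [_|k IH kK].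
    exists (fun i => l + i)%N; split=> [i|i j|]; first exact: leq_addr.
      by rewrite ltn_add2l.
    rewrite mul0r addr0 /F big_ord1 addn0 -[a *: x l]add0r; exact: step.
  have [n [ln nlt rF]] := IH (ltnW kK).
  pose u := a *: \sum_(i < k.+1) x (n i).
  have rFM : r <= N (F n k.+1) <= M.
    rewrite FM ?andbT //; last exact: ltnW.
    by apply: le_trans rF; rewrite lerDl mulr_ge0 // ltW.
  have wF : weakly_cvg (fun m => f (u + a *: x m) - f u) 0.
    by apply: weakly_cvg_sub; apply: wf; exact: weakly_cvg_affine.
  have [m0 _ hm0] := hc _ _ rFM wF (step u).
  pose m := maxn m0 (n k).+1.
  have nm : (n k < m)%N by rewrite leq_maxr.
  (* The first [k.+1] indices are kept and [m + k.+1] is the new one; later values only keep the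
     sequence strictly increasing. The choice of [m] puts the tail above [n k] and past the
     threshold [m0]. *)
  exists (fun i => if (i <= k)%N then n i else m + i)%N; split => [i|i j ij|].
  - case: ifP => // _; apply: leq_trans (leq_addr _ _).
    by rewrite (leq_trans (ln k)) // ltnW.
  - case: (leqP j k) => jk.
      by rewrite (leq_trans (ltnW ij) jk); exact: nlt.
    case: (leqP i k) => ik; last by rewrite ltn_add2l.
    apply: leq_trans (leq_addr _ _); apply: leq_ltn_trans nm.
    by move: ik; rewrite leq_eqVlt => /predU1P[->//|/nlt/ltnW].
  - have -> : F (fun i => if (i <= k)%N then n i else (m + i)%N) k.+2 =
        F n k.+1 + (f (u + a *: x (m + k.+1)%N) - f u).
      rewrite /F big_ord_recr /= ltnn -/u.
      under eq_bigr => i _ do rewrite -ltnS ltn_ord.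
      by rewrite scalerDr -/u [RHS]addrC addrA subrK.
    have le_m0 : (m0 <= m + k.+1)%N.
      by apply: leq_trans (leq_addr _ _); rewrite leq_maxl.
    rewrite -natr1 mulrDl mul1r addrA; apply: le_trans (hm0 _ le_m0).
    by rewrite lerD2r.
have [n [ln nlt]] := grow K (leqnn K).
have := FM n K.+1 (leqnn _) ln nlt.
have : M / c < K%:R.
  by apply/archi_boundP/divr_ge0; rewrite ltW // (lt_le_trans r0).
rewrite ltr_pdivrMr //; lra.
Qed.
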